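(* Let the window $W\subset\mathbb{R}^d$ be given as an intersection of finitely many halfspaces, $W=\{x\mid Ax\leq b\}$ with $A\in\mathbb{R}^{l\times d}$ and $b\in\mathbb{R}^l$, where $d$, $A$ and $b$ are fixed (not part of the input). Then, for any finite set $P\subset\mathbb{R}^d$, the set $\operatorname{Sep}_{W^\circ}(P)$ can be computed with $O(\operatorname{card}(P)^{d+1})$ operations in the real RAM model.
   Context: For $P,W\subset\mathbb{R}^d$ and $t\in\mathbb{R}^d$, let $S_{W,t}(P)=P\cap(t+W)$ and $\operatorname{Sep}_W(P)=\{S_{W,t}(P)\mid t\in\mathbb{R}^d\}$. $W^\circ$ denotes the interior of $W$. The real RAM model counts each elementary operation on real numbers at unit cost. *)

(* Defs.v *)
From HB Require Import structures.
From mathcomp Require Import all_boot all_order all_algebra.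
From mathcomp Require Import all_classical all_reals.
From mathcomp Require Import topology normedtype.
Set Implicit Arguments. Unset Strict Implicit. Unset Printing Implicit Defensive.
Import Order.TTheory GRing.Theory Num.Theory.
Import numFieldNormedType.Exports.
Local Open Scope classical_set_scope.
Local Open Scope ring_scope.

Definition window (R : realType) (l d : nat) (A : 'M[R]_(l, d)) (b : 'cV[R]_l)
  : set 'rV[R]_d :=
  [set x | forall i : 'I_l, (A *m x^T) i ord0 <= b i ord0].

Definition Sdot (R : realType) (d : nat) (W P : set 'rV[R]_d) (t : 'rV[R]_d)
  : set 'rV[R]_d :=
  P `&` [set t + w | w in W].

Definition Sep (R : realType) (d : nat) (W P : set 'rV[R]_d) : set (set 'rV[R]_d) :=
  [set Sdot W P t | t in [set: 'rV[R]_d]].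

(* Real registers (indexed by nat), nat registers (indexed by nat), indirect
   addressing through nat registers, unit cost per executed instruction.
   Output: a sequence of finite sets of input indices. *)

Inductive rop := RAdd | RSub | RMul | RDiv.
Inductive iop := IAdd | ISub.  (* ISub is truncated subtraction on nat *)

Inductive instr (R : realType) :=
| RConst   of R & nat
| RArith   of rop & nat & nat & nat
| RLoad    of nat & nat
| RStore   of nat & nat
| RJlt     of nat & nat & nat
| RJeq     of nat & nat & nat
| IConst   of nat & nat
| IArith   of iop & nat & nat & nat
| ILoad    of nat & nat
| IStore   of nat & nat
| IJlt     of nat & nat & nat
| IJeq     of nat & nat & nat
| OutElem  of nat
| OutClose
| Halt.

Record config (R : realType) := Config {
  pc   : nat;
  rreg : nat -> R;
  ireg : nat -> nat;
  cur  : seq nat;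
  outs : seq (seq nat) }.

Definition upd (T : Type) (f : nat -> T) (k : nat) (v : T) : nat -> T :=
  fun j => if j == k then v else f j.

Definition eval_rop (R : realType) (o : rop) (x y : R) : R :=
  match o with RAdd => x + y | RSub => x - y | RMul => x * y | RDiv => x / y end.

Definition eval_iop (o : iop) (x y : nat) : nat :=
  match o with IAdd => (x + y)%N | ISub => (x - y)%N end.

Definition fetch (R : realType) (prog : seq (instr R)) (p : nat) : instr R :=
  nth (Halt R) prog p.

Definition halted (R : realType) (prog : seq (instr R)) (c : config R) : bool :=
  if fetch prog (pc c) is Halt then true else false.

Definition step (R : realType) (prog : seq (instr R)) (c : config R) : config R :=
  let: Config p r i cu o := c in
  let nx := p.+1 in
  match fetch prog p with
  | RConst x dst => Config nx (upd r dst x) i cu o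
  | RArith op dst s1 s2 => Config nx (upd r dst (eval_rop op (r s1) (r s2))) i cu o
  | RLoad dst a => Config nx (upd r dst (r (i a))) i cu o
  | RStore a src => Config nx (upd r (i a) (r src)) i cu o
  | RJlt s1 s2 t => Config (if r s1 < r s2 then t else nx) r i cu o
  | RJeq s1 s2 t => Config (if r s1 == r s2 then t else nx) r i cu o
  | IConst k dst => Config nx r (upd i dst k) cu o
  | IArith op dst s1 s2 => Config nx r (upd i dst (eval_iop op (i s1) (i s2))) cu o
  | ILoad dst a => Config nx r (upd i dst (i (i a))) cu o
  | IStore a src => Config nx r (upd i (i a) (i src)) cu o
  | IJlt s1 s2 t => Config (if (i s1 < i s2)%N then t else nx) r i cu o
  | IJeq s1 s2 t => Config (if i s1 == i s2 then t else nx) r i cu o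
  | OutElem s => Config nx r i (i s :: cu) o
  | OutClose => Config nx r i [::] (rcons o cu)
  | Halt => c
  end.

Definition run (R : realType) (prog : seq (instr R)) (k : nat) (c : config R) :=
  iter k (step prog) c.

(* Input encoding of a list of points s = [p_0; ...; p_{n-1}] in R^d:
   ireg[0] = n, rreg[i*d + j] = coordinate j of p_i, everything else 0. *)
Definition init (R : realType) (d : nat) (s : seq 'rV[R]_d) : config R :=
  Config 0
    (fun a => if (a < size s * d)%N then
                (if [pick j : 'I_d | val j == (a %% d)%N] is Some j
                 then (nth 0 s (a %/ d)) ord0 j else 0)
              else 0)
    (fun j => if j == 0%N then size s else 0%N)
    [::] [::].

Definition decode (R : realType) (d : nat) (s : seq 'rV[R]_d) (out : seq (seq nat))
  : set (set 'rV[R]_d) :=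
  [set Q | exists2 c, c \in out &
     Q = [set x | exists2 i, i \in c & x = nth 0 s i]].

Definition computes_within (R : realType) (d : nat) (prog : seq (instr R))
  (s : seq 'rV[R]_d) (N : nat) (F : set (set 'rV[R]_d)) : Prop :=
  exists2 k, (k <= N)%N &
    let c := run prog k (init s) in
    [/\ halted prog c,
        all (all (fun i => (i < size s)%N)) (outs c)
      & decode s (outs c) = F].

(* Main.v *)
(* For a fixed row i of A and a point p, {t | A_i t = A_i p - b_i} is a hyperplane,
   and P `&` (t + interior W) is determined by the set of these hyperplanes having t
   strictly on their positive side. Every t can be written v + u where v is a
   vertex of the arrangement lying in the closure of the face of t (the coordinate
   hyperplanes through the points being added to ensure that vertices exist), and
   then v + eps u lies in the same face for all small eps > 0. A vertex is given by
   d rows and d points, hence there are O(n^d) of them. Since all hyperplanes are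
   translates of finitely many, only the signs of A_i u matter for the direction u,
   so finitely many sign vectors, independent of P, suffice; those realized by
   some u, and the inverses of the d x d submatrices, are hard-wired in the program.
   Membership of p in the set attached to (v, u) is decided in constant time: for
   each i, the affine form A_i v - A_i p + b_i is positive, or it vanishes and
   A_i u > 0. The point of index n, namely 0, is used along with the input points;
   this only adds hyperplanes and takes care of n = 0. *)
Require Import Defs.
From HB Require Import structures.
From mathcomp Require Import all_boot all_order all_algebra.
From mathcomp Require Import all_classical all_reals.
From mathcomp Require Import topology normedtype.
From mathcomp Require Import zify ring lra.
Import Order.TTheory GRing.Theory Num.Theory.
Import numFieldNormedType.Exports.
Local Open Scope classical_set_scope.
Local Open Scope ring_scope.

(** * Structured programs and their cost *)

Section StructuredRAM.
Set Implicit Arguments.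
Unset Strict Implicit.
Variable R : realType.
Local Arguments run : simpl never.
Local Arguments fetch : simpl never.

Local Notation rOne := 1%N.

(** The flag of [Unless] selects the comparison of two real registers under which the body is
    skipped: equality for [true], strict order for [false]. *)
Inductive cmd :=
| Atoms  of seq (instr R)
| Seq    of cmd & cmd
| Unless of bool & nat & nat & cmd
| For    of nat & nat & cmd.

Record state := State {
  reals : nat -> R;
  nats  : nat -> nat;
  cset  : seq nat;
  osets : seq (seq nat) }.

Definition at_pc (p : nat) (s : state) : config R :=
  Config p (reals s) (nats s) (cset s) (osets s).

Definition forget_pc (c : config R) : state :=
  State (rreg c) (ireg c) (cur c) (outs c).

Definition set_nat (s : state) (x v : nat) : state :=
  State (reals s) (upd (nats s) x v) (cset s) (osets s).

Definition straight (i : instr R) : bool :=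
  match i with
  | RJlt _ _ _ | RJeq _ _ _ | IJlt _ _ _ | IJeq _ _ _ | Halt => false
  | _ => true
  end.

Definition effect (s : state) (i : instr R) : state :=
  forget_pc (step [:: i] (at_pc 0 s)).

Fixpoint clen (c : cmd) : nat :=
  match c with
  | Atoms l => size l
  | Seq c1 c2 => clen c1 + clen c2
  | Unless _ _ _ c1 => (clen c1).+1
  | For _ _ c1 => clen c1 + 4
  end.

(* The loop is left as soon as the counter equals the bound, so the bound must
   not be overtaken; the increment relies on the register [rOne] holding 1. *)
Fixpoint gen (c : cmd) (p : nat) : seq (instr R) :=
  match c with
  | Atoms l => l
  | Seq c1 c2 => gen c1 p ++ gen c2 (p + clen c1)
  | Unless e a b c1 =>
      (if e then RJeq R a b (p.+1 + clen c1) else RJlt R a b (p.+1 + clen c1))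
        :: gen c1 p.+1
  | For x bd c1 =>
      [:: IConst R 0 x; IJeq R x bd (p + (clen c1 + 4))%N] ++ gen c1 p.+2 ++
      [:: IArith R IAdd x x rOne; IJeq R x x p.+1]
  end.

Lemma size_gen c p : size (gen c p) = clen c.
Proof.
elim: c p => //= [c1 IH1 c2 IH2|e a b c IH|x bd c IH] p.
- by rewrite size_cat IH1 IH2.
- by rewrite IH.
- by rewrite size_cat IH /= addn2 addn4.
Qed.

Definition located (prog : seq (instr R)) (p : nat) (code : seq (instr R)) :=
  forall j, (j < size code)%N -> fetch prog (p + j) = nth (Halt R) code j.

Lemma located_cat prog p l1 l2 :
  located prog p (l1 ++ l2) -> located prog p l1 /\ located prog (p + size l1) l2.
Proof.
move=> H; split=> j ltj.
- by rewrite H ?nth_cat ?ltj // size_cat ltn_addr.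
- by rewrite -addnA H ?nth_cat ?size_cat ?ltn_add2l // ltnNge leq_addr addKn.
Qed.

Lemma located_cons prog p i l :
  located prog p (i :: l) -> fetch prog p = i /\ located prog p.+1 l.
Proof.
move=> H; split=> [|j ltj]; first by rewrite -[p]addn0 (H 0).
by rewrite addSnnS H.
Qed.

Lemma runD prog k1 k2 (c : config R) :
  run prog (k1 + k2) c = run prog k2 (run prog k1 c).
Proof. by rewrite /run addnC iterD. Qed.

Lemma runS prog k (c : config R) : run prog k.+1 c = run prog k (step prog c).
Proof. by rewrite /run iterSr. Qed.

Lemma run1 prog (c : config R) : run prog 1 c = step prog c.
Proof. by []. Qed.

Lemma step_straight prog p i s :
  fetch prog p = i -> straight i -> step prog (at_pc p s) = at_pc p.+1 (effect s i).
Proof. by rewrite /step /= => ->; case: i. Qed.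

(* The code is position-independent, so that [wp] composes. *)
Definition wp (c : cmd) (s : state) (K : nat) (Q : state -> Prop) : Prop :=
  exists s' k, [/\ (k <= K)%N, Q s' &
    forall prog p, located prog p (gen c p) ->
      run prog k (at_pc p s) = at_pc (p + clen c) s'].

Lemma wp_weaken c s K K' (Q Q' : state -> Prop) :
  wp c s K Q -> (K <= K')%N -> (forall s', Q s' -> Q' s') -> wp c s K' Q'.
Proof.
move=> [s' [k [leK Qs' Hrun]]] leKK' QQ'; exists s', k; split=> //.
- exact: leq_trans leKK'.
- exact: QQ'.
Qed.

Lemma wp_atoms l s : all straight l -> wp (Atoms l) s (size l) (eq (foldl effect s l)).
Proof.
move=> Hl; exists (foldl effect s l), (size l); split=> // prog.
elim: l s Hl => [|i l IH] s /= Hl p Hloc; first by rewrite addn0.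
move: Hl Hloc => /andP[Hi Hl] /located_cons[Hf Hloc].
by rewrite runS (step_straight _ Hf) // IH // addSnnS.
Qed.

Lemma wp_seq c1 c2 s K1 K2 Q :
  wp c1 s K1 (fun s1 => wp c2 s1 K2 Q) -> wp (Seq c1 c2) s (K1 + K2) Q.
Proof.
move=> [s1 [k1 [le1 [s2 [k2 [le2 Qs2 Hr2]]] Hr1]]].
exists s2, (k1 + k2)%N; split=> //; first exact: leq_add.
move=> prog p /= /located_cat[]; rewrite size_gen => L1 L2.
by rewrite runD Hr1 // Hr2 // addnA.
Qed.

Definition skips (e : bool) (a b : nat) (s : state) : bool :=
  if e then reals s a == reals s b else reals s a < reals s b.

Lemma wp_unless e a b c s K (Q : state -> Prop) :
  (if skips e a b s then Q s else wp c s K Q) -> wp (Unless e a b c) s K.+1 Q.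
Proof.
have jumpE prog p : located prog p (gen (Unless e a b c) p) ->
    step prog (at_pc p s) =
    at_pc (if skips e a b s then (p + clen (Unless e a b c))%N else p.+1) s.
  move=> /located_cons[Hf _]; rewrite /step /= Hf /skips.
  by case: (e); rewrite /at_pc addnS addSn.
case sk: skips jumpE => jumpE.
  by move=> Qs; exists s, 1%N; split=> // prog p /jumpE; rewrite run1.
move=> [s' [k [leK Qs' Hr]]]; exists s', k.+1; split=> // prog p Hloc.
rewrite runS jumpE //; case/located_cons: Hloc => _ /Hr ->.
by rewrite addSnnS.
Qed.

(** The 3 extra steps per round are the exit test, the increment and the jump back; the final 2 are
    the initialisation and the last exit test. The invariant is asked after the increment, hence the
    [set_nat]. *)
Lemma wp_for x bd c K m (I : nat -> state -> Prop) s :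
  I 0 (set_nat s x 0) -> x != bd -> nats s bd = m ->
  (forall j s1, (j < m)%N -> nats s1 x = j -> I j s1 ->
    wp c s1 K (fun s2 => [/\ nats s2 x = j, nats s2 bd = m, nats s2 rOne = 1%N
                           & I j.+1 (set_nat s2 x j.+1)])) ->
  wp (For x bd c) s (m * (K + 3) + 2) (fun s' => I m s' /\ nats s' x = m).
Proof.
move=> I0 xbd bdm Hbody.
(* Induction on the number [r] of remaining rounds, entering at the exit test [p.+1] and not at the
   initialisation. *)
have loop r : forall j s1, (j + r = m)%N -> nats s1 x = j -> nats s1 bd = m ->
    I j s1 -> exists s' k, [/\ (k <= r * (K + 3) + 1)%N, I m s' /\ nats s' x = m &
      forall prog p, located prog p (gen (For x bd c) p) ->
        run prog k (at_pc p.+1 s1) = at_pc (p + clen (For x bd c)) s'].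
  elim: r => [|r IH] j s1 jrm s1x s1bd Ij.
    exists s1, 1%N; rewrite -jrm addn0 in Ij s1bd *; split=> // prog p.
    case/located_cons=> _ /located_cons[Hf _].
    by rewrite run1 /step /= Hf s1x s1bd eqxx.
  have ltjm : (j < m)%N by rewrite -jrm -addSnnS leq_addr.
  have [s2 [k [leK [s2x s2bd s2one Is2] Hr]]] := Hbody j s1 ltjm s1x Ij.
  have [] := IH j.+1 (set_nat s2 x j.+1) _ _ _ Is2.
  - by rewrite addSnnS.
  - by rewrite /= /upd eqxx.
  - by rewrite /= /upd eq_sym (negbTE xbd).
  move=> s' [k' [leK' HI Hr']]; exists s', (k + 3 + k')%N; split=> //.
    rewrite mulSn -(addnA (K + 3)%N); apply: leq_add => //.
    by rewrite leq_add2r.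
  move=> prog p Hloc; have := Hloc.
  case/located_cons=> _ /located_cons[Hf] /located_cat[Hc].
  rewrite size_gen => /located_cons[Hadd] /located_cons[Hjmp _].
  have -> : (k + 3 + k' = 1 + (k + (2 + k')))%N by lia.
  rewrite runD run1 {1}/step /= Hf s1x s1bd ltn_eqF // !runD Hr // !runS.
  rewrite {1}/step /= Hadd Hjmp eqxx /= s2x s2one addn1.
  exact: Hr'.
have [] := loop m 0%N (set_nat s x 0) _ _ _ I0; rewrite ?add0n //=.
- by rewrite /upd eqxx.
- by rewrite /upd eq_sym (negbTE xbd).
move=> s' [k [leK HI Hr]]; exists s', k.+1; split=> //.
  by rewrite addn2 ltnS -addn1.
move=> prog p Hloc; have [Hf _] := located_cons Hloc.
by rewrite runS {1}/step /= Hf Hr.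
Qed.

End StructuredRAM.

(** * Enumerating the sets cut out by affine tests *)

Section AffineTests.
Set Implicit Arguments.
Unset Strict Implicit.
Variables (R : realType) (d : nat).
Local Arguments run : simpl never.
Local Arguments fetch : simpl never.

(* Natural registers: [rSize], [rOne], [rSucc] hold n, 1, n+1; [rBase] is the
   address of the first input coordinate; [rAddr] is a scratch address;
   [rVar k] is the k-th loop variable, an index of an input point.
   Real registers: [fAcc], [fVal], [fTmp] are scratch. *)
Local Notation rSize := 0%N.
Local Notation rOne := 1%N.
Local Notation rSucc := 2%N.
Local Notation rBase := 3%N.
Local Notation rAddr := 4%N.
Local Notation rVar k := (5 + k)%N.
Local Notation fAcc := 0%N.
Local Notation fVal := 1%N.
Local Notation fTmp := 2%N.

(* [t_closed] tells whether the value 0 passes the test. *)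
Record test := Test {
  t_const  : R;
  t_coef   : nat -> nat -> R;
  t_closed : bool }.

Definition test_val (mem : nat -> R) (T : test) (x : nat -> nat) : R :=
  t_const T + \sum_(k < d.+1) \sum_(m < d) t_coef T k m * mem (x k * d + m)%N.

Definition passes (mem : nat -> R) (T : test) (x : nat -> nat) : bool :=
  (0 < test_val mem T x) || t_closed T && (test_val mem T x == 0).

Definition vars (s : state R) (k : nat) : nat := nats s (rVar k).

Definition scratch_equiv (s s' : state R) : Prop :=
  [/\ forall a, a != rAddr -> nats s' a = nats s a,
      forall a, (3 <= a)%N -> reals s' a = reals s a,
      cset s' = cset s & osets s' = osets s].

Lemma scratch_equiv_trans s1 s2 s3 :
  scratch_equiv s1 s2 -> scratch_equiv s2 s3 -> scratch_equiv s1 s3.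
Proof.
move=> [n1 r1 c1 o1] [n2 r2 c2 o2]; split; rewrite ?c2 ?o2 // => a Ha.
- by rewrite n2 ?n1.
- by rewrite r2 ?r1.
Qed.

(** * Straight-line code evaluating an affine test *)

Definition term_code (w : R) : seq (instr R) :=
  [:: RLoad R fVal rAddr; RConst w fTmp; RArith R RMul fVal fTmp fVal;
      RArith R RAdd fAcc fAcc fVal; IArith R IAdd rAddr rAddr rOne].

Definition terms_code (w : nat -> R) (j : nat) : seq (instr R) :=
  flatten [seq term_code (w m) | m <- iota 0 j].

(** Natural registers can be added but not multiplied, so the offset of a point is reached by [d]
    additions; the length still depends on [d] only. *)
Definition point_code (w : nat -> R) (k : nat) : seq (instr R) :=
  [:: IConst R 0 rAddr; IArith R IAdd rAddr rAddr rBase] ++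
  nseq d (IArith R IAdd rAddr rAddr (rVar k)) ++ terms_code w d.

Definition points_code (w : nat -> nat -> R) (j : nat) : seq (instr R) :=
  flatten [seq point_code (w k) k | k <- iota 0 j].

Definition test_code (T : test) : seq (instr R) :=
  RConst (t_const T) fAcc :: points_code (t_coef T) d.+1 ++ [:: RConst 0 fTmp].

Lemma effect_term w s : nats s rOne = 1%N ->
  let s' := foldl (@effect R) s (term_code w) in
  [/\ scratch_equiv s s', nats s' rAddr = (nats s rAddr).+1
    & reals s' fAcc = reals s fAcc + w * reals s (nats s rAddr)].
Proof.
move=> one; split=> //=; last by rewrite one addn1.
by split=> // -[|[|[|[|[|a]]]]].
Qed.

Lemma flatten_iotaS T (f : nat -> seq T) j :
  flatten [seq f k | k <- iota 0 j.+1] = flatten [seq f k | k <- iota 0 j] ++ f j.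
Proof. by rewrite -addn1 iotaD map_cat flatten_cat; congr (_ ++ _); exact: cats0. Qed.

(** An address of at least 3 keeps the operands clear of the real scratch registers, so accumulating
    one term cannot alter a later one. *)
Lemma effect_terms w j s : nats s rOne = 1%N -> (3 <= nats s rAddr)%N ->
  let s' := foldl (@effect R) s (terms_code w j) in
  [/\ scratch_equiv s s', nats s' rAddr = (nats s rAddr + j)%N
    & reals s' fAcc =
      reals s fAcc + \sum_(m < j) w m * reals s (nats s rAddr + m)%N].
Proof.
move=> one adr; elim: j => [|j [E A V]].
  by rewrite big_ord0 addr0 addn0.
rewrite /terms_code flatten_iotaS foldl_cat.
have [|E' A' V'] := effect_term (w j) (s := foldl (@effect R) s (terms_code w j)).
  by case: E => ->.
split; first exact: scratch_equiv_trans E E'.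
  by rewrite A' A addnS.
have lt3 : (3 <= nats s rAddr + j)%N by rewrite ltn_addr.
by rewrite V' V A big_ord_recr /= addrA; case: E => _ -> //.
Qed.

Record inv (n base : nat) (mem : nat -> R) (s : state R) : Prop := Inv {
  inv_size : nats s rSize = n;
  inv_one  : nats s rOne = 1%N;
  inv_succ : nats s rSucc = n.+1;
  inv_base : nats s rBase = base;
  inv_base_ge : (3 <= base)%N;
  inv_mem  : forall a, reals s (base + a) = mem a }.

Lemma inv_scratch n base mem s s' :
  inv n base mem s -> scratch_equiv s s' -> inv n base mem s'.
Proof.
move=> [H0 H1 H2 H3 H4 H5] [En Er _ _]; split=> //; rewrite ?En // => a.
by rewrite Er // ltn_addr.
Qed.

Lemma vars_scratch s s' : scratch_equiv s s' -> vars s' = vars s.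
Proof. by move=> [En _ _ _]; apply/funext => k; rewrite /vars En. Qed.

Lemma effect_point n base mem w k s : inv n base mem s ->
  let s' := foldl (@effect R) s (point_code w k) in
  scratch_equiv s s' /\
  reals s' fAcc = reals s fAcc + \sum_(m < d) w m * mem (vars s k * d + m)%N.
Proof.
move=> Hinv; rewrite /point_code !foldl_cat.
set s1 := foldl _ s _; set s2 := foldl _ s1 _.
have [E1 A1 V1] : [/\ scratch_equiv s s1, nats s1 rAddr = base
                    & reals s1 = reals s].
  split=> //; last by rewrite -(inv_base Hinv).
  by split=> // -[|[|[|[|[|a]]]]].
have [E2 A2 V2] : [/\ scratch_equiv s1 s2,
    nats s2 rAddr = (base + vars s k * d)%N & reals s2 = reals s].
  rewrite {}/s2; elim: (d) => [|j [E A V]].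
    by rewrite muln0 addn0.
  rewrite -addn1 nseqD foldl_cat /=; set s2 := foldl _ s1 _ in E A V *.
  split=> //=.
    apply: scratch_equiv_trans E _; split=> //= a.
    by rewrite /upd => /negbTE ->.
  rewrite /upd /= A; case: E => -> // _ _ _; case: E1 => -> // _ _ _.
  by rewrite mulnDr muln1 addnA.
have E := scratch_equiv_trans E1 E2.
have Hinv2 := inv_scratch Hinv E.
have [||E3 A3 V3] := @effect_terms w d s2.
- exact: inv_one Hinv2.
- by rewrite A2 ltn_addr // (inv_base_ge Hinv).
split; first exact: scratch_equiv_trans E E3.
rewrite V3 V2 A2; congr (_ + _); apply: eq_bigr => m _.
by rewrite -addnA -(inv_mem Hinv).
Qed.

Lemma effect_points n base mem w j s : inv n base mem s ->
  let s' := foldl (@effect R) s (points_code w j) in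
  scratch_equiv s s' /\
  reals s' fAcc = reals s fAcc +
    \sum_(k < j) \sum_(m < d) w k m * mem (vars s k * d + m)%N.
Proof.
move=> Hinv; elim: j => [|j [E V]]; first by rewrite big_ord0 addr0.
rewrite /points_code flatten_iotaS foldl_cat.
have [E' V'] := effect_point (w j) j (inv_scratch Hinv E).
split; first exact: scratch_equiv_trans E E'.
by rewrite V' V (vars_scratch E) big_ord_recr /= addrA.
Qed.

Lemma effect_test n base mem T s : inv n base mem s ->
  let s' := foldl (@effect R) s (test_code T) in
  [/\ scratch_equiv s s', reals s' fAcc = test_val mem T (vars s)
    & reals s' fTmp = 0].
Proof.
move=> Hinv; rewrite /test_code [foldl _ _ _]/= foldl_cat.
set s1 := effect s _.
have E1 : scratch_equiv s s1 by split=> // -[|[|[|a]]].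
have [E2 V2] := effect_points (t_coef T) d.+1 (inv_scratch Hinv E1).
set s2 := foldl _ s1 _ in E2 V2 *.
split=> //.
apply: (scratch_equiv_trans E1); apply: (scratch_equiv_trans E2).
by split=> // -[|[|[|a]]].
Qed.

Lemma straight_test T : all (@straight R) (test_code T).
Proof.
have Hpt w k : all (@straight R) (point_code w k).
  by rewrite !all_cat all_nseq orbT /= /terms_code; elim: (iota 0 d).
have Hpts l : all (@straight R) (flatten [seq point_code (t_coef T k) k | k <- l]).
  by elim: l => // k l IH; rewrite all_cat Hpt.
by rewrite /test_code -cat1s all_cat all_cat Hpts.
Qed.

(** * Branching on tests and scanning the points *)

Fixpoint guarded (Ts : seq test) (c : cmd R) : cmd R :=
  if Ts is T :: Ts' then
    Seq (Atoms (test_code T)) (Unless false fAcc fTmp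
      (if t_closed T then guarded Ts' c
       else Unless true fAcc fTmp (guarded Ts' c)))
  else c.

Definition guarded_cost (Ts : seq test) (K : nat) : nat :=
  foldr (fun T m => size (test_code T) + m.+2)%N K Ts.

(** Evaluating tests changes scratch registers only. A failed test jumps past everything that
    remains, so [Q] must then hold at once, whatever the scratch registers contain. *)
Lemma wp_guarded n base mem Ts c s K (Q : state R -> Prop) : inv n base mem s ->
  (forall s', scratch_equiv s s' ->
     if all (fun T => passes mem T (vars s)) Ts then wp c s' K Q else Q s') ->
  wp (guarded Ts c) s (guarded_cost Ts K) Q.
Proof.
elim: Ts s => [|T Ts IH] s Hinv H /=; first exact: H.
apply: wp_seq; apply: wp_weaken (wp_atoms s (straight_test T)) _ _ => // s1 <-.
have [E V Z] := effect_test T Hinv; set s2 := foldl _ s _ in E V Z *.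
have Hinv2 := inv_scratch Hinv E.
have H2 : passes mem T (vars s) -> wp (guarded Ts c) s2 (guarded_cost Ts K) Q.
  move=> pT; apply: IH => // s3 E3; have := H _ (scratch_equiv_trans E E3).
  by rewrite /= pT (vars_scratch E).
have H3 : ~~ passes mem T (vars s) -> Q s2.
  by move=> pT; have := H _ E; rewrite /= (negbTE pT).
apply: wp_unless; rewrite /skips V Z.
rewrite /passes in H2 H3; set v := test_val _ _ _ in H2 H3 *.
have [v0|v0] := ltrP v 0.
  by apply: H3; rewrite (lt_gtF v0) (lt_eqF v0) andbF.
case: (t_closed T) H2 H3 => H2 H3.
  by apply: wp_weaken (H2 _) _ _ => //; rewrite orbC eq_sym -le_eqVlt.
apply: wp_unless; rewrite /skips V Z -/v.
have [v00|vn0] := eqVneq v 0; first by apply: H3; rewrite v00 ltxx.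
by apply: H2; rewrite lt_def vn0 v0.
Qed.

Lemma vars_set_var s k v : vars (set_nat s (rVar k) v) = upd (vars s) k v.
Proof. by apply/funext => j; rewrite /vars /set_nat /upd /= eqn_add2l. Qed.

Lemma inv_set_var n base mem s k v :
  inv n base mem s -> inv n base mem (set_nat s (rVar k) v).
Proof. by case. Qed.

Lemma passes_ext mem T x y :
  (forall k, (k <= d)%N -> x k = y k) -> passes mem T x = passes mem T y.
Proof.
move=> xy; rewrite /passes; suff -> : test_val mem T x = test_val mem T y by [].
congr (_ + _); apply: eq_bigr => k _; apply: eq_bigr => m _.
by rewrite xy // -ltnS.
Qed.

(** Slots below [d] of [x] stay fixed and slot [d] runs over the points. The reversal reflects that
    [OutElem] puts each new index in front. *)
Definition selected (n : nat) (mem : nat -> R) (Ts : seq test) (x : nat -> nat) :=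
  rev [seq p <- iota 0 n | all (fun T => passes mem T (upd x d p)) Ts].

Lemma selected_ext n mem Ts x y :
  (forall k, (k < d)%N -> x k = y k) -> selected n mem Ts x = selected n mem Ts y.
Proof.
move=> xy; congr rev; apply: eq_filter => p; apply: eq_all => T.
apply: passes_ext => k; rewrite /upd leq_eqVlt; case: eqP => //= _; exact: xy.
Qed.

Definition select_code (Ts : seq test) : cmd R :=
  Seq (For (rVar d) rSize (guarded Ts (Atoms [:: OutElem R (rVar d)])))
      (Atoms [:: OutClose R]).

Lemma wp_select n base mem Ts s : inv n base mem s -> cset s = [::] ->
  wp (select_code Ts) s (n * (guarded_cost Ts 1 + 3) + 2 + 1)
    (fun s' => [/\ inv n base mem s', forall k, (k < d)%N -> vars s' k = vars s k,
       cset s' = [::] & osets s' = rcons (osets s) (selected n mem Ts (vars s))]).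
Proof.
move=> Hinv cs0; apply: wp_seq.
pose ok p := all (fun T => passes mem T (upd (vars s) d p)) Ts.
pose I j s1 := [/\ inv n base mem s1, forall k, (k < d)%N -> vars s1 k = vars s k,
  cset s1 = rev [seq p <- iota 0 j | ok p] & osets s1 = osets s].
have varsE s1 v k : (k < d)%N -> vars (set_nat s1 (rVar d) v) k = vars s1 k.
  by move=> ltkd; rewrite vars_set_var /upd ltn_eqF.
apply: wp_weaken (@wp_for _ _ _ _ (guarded_cost Ts 1) n I s _ _ _ _) _ _ => //.
- by split=> //; [exact: inv_set_var|exact: varsE].
- exact: inv_size Hinv.
- move=> j s1 ltjn s1j [inv1 vars1 cs1 os1]; apply: (wp_guarded inv1) => s2 E.
  have vE : all (fun T => passes mem T (vars s1)) Ts = ok j.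
    apply: eq_all => T; apply: passes_ext => k; rewrite /upd leq_eqVlt.
    by case: eqP => [->|_] //=; exact: vars1.
  have inv2 := inv_scratch inv1 E; have v2 := vars_scratch E.
  case: (E) => n2 _ c2 o2.
  pose sel i := rev [seq p <- iota 0 i | ok p].
  have selS : sel j.+1 = if ok j then j :: sel j else sel j.
    rewrite /sel -addn1 iotaD cats1 filter_rcons add0n.
    by case: ifP => // _; rewrite rev_rcons.
  rewrite vE; case: ifP => okj.
    apply: wp_weaken (wp_atoms _ _) _ _ => // s3 <- /=; split.
    + by rewrite n2.
    + exact: inv_size inv2.
    + exact: inv_one inv2.
    split=> //=; first by case: inv2.
    + by move=> k ltkd; rewrite -vars1 // -v2; exact: (varsE s2 j.+1).
    + by rewrite -[RHS]/(sel j.+1) selS okj n2 // s1j c2 cs1.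
    + by rewrite o2.
  split=> //; [by rewrite n2|exact: inv_size inv2|exact: inv_one inv2|].
  split=> //=; first exact: inv_set_var.
  + by move=> k ltkd; rewrite -vars1 // -v2; exact: (varsE s2 j.+1).
  + by rewrite -[RHS]/(sel j.+1) selS okj c2 cs1.
  + by rewrite o2.
move=> s1 [[inv1 vars1 cs1 os1] _].
apply: wp_weaken (wp_atoms _ _) _ _ => // s2 <- /=; split=> //=.
- by case: inv1.
- by rewrite os1 cs1.
Qed.

(** * Nested loops over tuples of point indices *)

Fixpoint nest (k : nat) (c : cmd R) : cmd R :=
  if k is k'.+1 then For (rVar k') rSucc (nest k' c) else c.

(** Induction on the number of loops. The bound [rSucc] lets each variable also take the value [n],
    the index of the extra point 0. The output is described by membership alone, since decoding
    ignores order and repetition. *)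
Lemma wp_nest n base mem c K (F : (nat -> nat) -> seq nat) :
  (forall x y, (forall k, (k < d)%N -> x k = y k) -> F x = F y) ->
  (forall s, inv n base mem s -> cset s = [::] ->
    wp c s K (fun s' => [/\ inv n base mem s',
      forall k, (k < d)%N -> vars s' k = vars s k,
      cset s' = [::] & osets s' = rcons (osets s) (F (vars s))])) ->
  forall k s, (k <= d)%N -> inv n base mem s -> cset s = [::] ->
  wp (nest k c) s (K.+1 * (6 * n.+1) ^ k) (fun s' => [/\ inv n base mem s',
    forall i, (k <= i < d)%N -> vars s' i = vars s i, cset s' = [::] &
    exists2 O, osets s' = osets s ++ O & forall q, q \in O <->
      exists g, [/\ forall i, (i < k)%N -> (g i <= n)%N,
        forall i, (k <= i < d)%N -> g i = vars s i & q = F g]]).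
Proof.
move=> extF Hc; elim=> [|k IH] s lekd Hinv cs0.
  rewrite expn0 muln1; apply: wp_weaken (Hc s Hinv cs0) _ _ => // s' [i' v' c' o'].
  split=> //; exists [:: F (vars s)]; first by rewrite cats1.
  move=> q; rewrite inE; split=> [/eqP->|[g [_ gE ->]]]; first by exists (vars s).
  by rewrite (extF g (vars s)).
pose I j s1 := [/\ inv n base mem s1,
  forall i, (k < i < d)%N -> vars s1 i = vars s i, cset s1 = [::] &
  exists2 O, osets s1 = osets s ++ O & forall q, q \in O <->
      exists g, [/\ forall i, (i < k)%N -> (g i <= n)%N, (g k < j)%N,
        forall i, (k < i < d)%N -> g i = vars s i & q = F g]].
set K' := (K.+1 * (6 * n.+1) ^ k)%N in IH.
have K'gt0 : (0 < K')%N by rewrite muln_gt0 expn_gt0.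
have varsE s1 v i : (k < i)%N -> vars (set_nat s1 (rVar k) v) i = vars s1 i.
  by move=> ltki; rewrite vars_set_var /upd gtn_eqF.
apply: (@wp_weaken _ _ _ _ _ _ _ (@wp_for _ _ _ _ K' n.+1 I s _ _ _ _)).
- split=> //; first exact: inv_set_var.
    by move=> i /andP[ltki _]; rewrite varsE.
  exists [::]; rewrite ?cats0 // => q; split=> // -[g []] //.
- by [].
- exact: inv_succ Hinv.
- move=> j s1 ltjn s1k [inv1 vars1 cs1 [O1 os1 O1P]].
  apply: wp_weaken (IH s1 (ltnW lekd) inv1 cs1) _ _ => //.
  move=> s2 [inv2 vars2 cs2 [O2 os2 O2P]]; split.
  + by rewrite -[LHS]/(vars s2 k) vars2 ?leqnn.
  + exact: inv_succ inv2.
  + exact: inv_one inv2.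
  split=> //; first exact: inv_set_var.
    move=> i /andP[ltki ltid]; rewrite varsE // vars2 ?(ltnW ltki) //.
    by rewrite vars1 // ltki.
  exists (O1 ++ O2); first by rewrite /= os2 os1 catA.
  move=> q; rewrite mem_cat; split.
    case/orP=> [/O1P[g [g1 g2 g3 ->]]|/O2P[g [g1 g2 ->]]].
      by exists g; split=> //; exact: ltnW.
    exists g; split=> // [|i /andP[ltki ltid]].
      by rewrite g2 ?leqnn // /vars s1k.
    by rewrite g2 ?(ltnW ltki) // vars1 // ltki.
  case=> g [g1 g2 g3 ->]; move: g2; rewrite ltnS leq_eqVlt => /orP[/eqP gk|ltgk].
    apply/orP; right; apply/O2P; exists g; split=> // i.
    rewrite leq_eqVlt => /andP[/orP[/eqP <- _|ltki ltid]]; first by rewrite gk -s1k.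
    by rewrite g3 ?ltki // vars1 // ltki.
  by apply/orP; left; apply/O1P; exists g.
(* Since [K'] is at least 1, (n+1)(K'+3)+2 is at most 6(n+1)K': this is the origin of the factor
   6. *)
- rewrite expnS mulnCA -/K' -mulnA; nia.
move=> s' [[inv' vars' cs' [O os' OP]] _]; split=> //; exists O => // q.
split=> [/OP[g [g1 g2 g3 ->]]|[g [g1 g2 ->]]].
  exists g; split=> // i; rewrite ltnS leq_eqVlt => /orP[/eqP->|]; last exact: g1.
  by rewrite -ltnS.
apply/OP; exists g; split=> // [i ltik|]; first exact/g1/ltnW.
by rewrite ltnS g1.
Qed.

Section Enumeration.
Variables (I : eqType) (Ts : I -> seq test).

Fixpoint enum_code (r : seq I) : cmd R :=
  if r is i :: r' then Seq (nest d (select_code (Ts i))) (enum_code r')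
  else Atoms [::].

Definition enum_cost (r : seq I) : nat :=
  (\sum_(i <- r) (guarded_cost (Ts i) 1 + 4) * 6 ^ d)%N.

Lemma wp_enum n base mem r s : inv n base mem s -> cset s = [::] ->
  wp (enum_code r) s (enum_cost r * n.+1 ^ d.+1)
    (fun s' => exists2 O, osets s' = osets s ++ O & forall q, q \in O <->
      exists i, i \in r /\ exists g, (forall k, (k < d)%N -> (g k <= n)%N) /\
        q = selected n mem (Ts i) g).
Proof.
elim: r s => [|i r IH] s Hinv cs0 /=.
  rewrite /enum_cost big_nil mul0n; apply: wp_weaken (wp_atoms _ _) _ _ => // s' <-.
  by exists [::]; rewrite ?cats0 // => q; split=> // -[? []].
rewrite /enum_cost big_cons mulnDl; apply: wp_seq.
have extF := @selected_ext n mem (Ts i).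
have Hsel s1 := @wp_select n base mem (Ts i) s1.
apply: wp_weaken (wp_nest extF Hsel (leqnn d) Hinv cs0) _ _.
  set G := guarded_cost _ _; rewrite expnMn expnS.
  (* The scan over the tested points supplies the last factor of [n.+1 ^ d.+1]; the [d] nested loops
     supply the others. *)
  have le : ((n * (G + 3) + 2 + 1).+1 <= (G + 4) * n.+1)%N by nia.
  apply: leq_trans (leq_mul le (leqnn _)) _.
  by rewrite -!mulnA leq_mul2l [(6 ^ d * (_ * _))%N]mulnCA leqnn orbT.
move=> s1 [inv1 _ cs1 [O1 os1 O1P]].
apply: wp_weaken (IH s1 inv1 cs1) _ _ => // s2 [O2 os2 O2P].
exists (O1 ++ O2); first by rewrite os2 os1 catA.
move=> q; rewrite mem_cat; split.
  case/orP=> [/O1P[g [g1 _ ->]]|/O2P[i' [i'r Hg]]].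
    by exists i; rewrite mem_head; split=> //; exists g.
  by exists i'; rewrite inE i'r orbT.
case=> i' []; rewrite inE => /orP[/eqP->|i'r] [g [g1 ->]]; apply/orP.
  left; apply/O1P; exists g; split=> // k /andP[ledk].
  by rewrite ltnNge ledk.
by right; apply/O2P; exists i'; split=> //; exists g.
Qed.

(** * Relocating the input and assembling the program *)

Local Notation rLen := 6%N.

(** [rLen] shares its register with [rVar 1]. This is harmless: it serves only until the input has
    been moved, and each later loop resets its own variable. *)
Definition setup_code : seq (instr R) :=
  [:: IConst R 1 rOne; IArith R IAdd rSucc rSize rOne; IConst R 0 rLen] ++
  nseq d (IArith R IAdd rLen rLen rSize) ++
  [:: IConst R 3 rBase; IArith R IAdd rBase rBase rLen].

(* The input occupies the low real registers, the only ones that arithmetic can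
   address; it is moved up by its own length plus 3. Register [fAcc] serves as
   the buffer: in the first round, loading cell 0 into it changes nothing. *)
Definition copy_code : cmd R :=
  For (rVar 0) rLen (Atoms [:: RLoad R fAcc (rVar 0);
    IArith R IAdd rAddr rBase (rVar 0); RStore R rAddr fAcc]).

Definition main_code (r : seq I) : cmd R :=
  Seq (Atoms setup_code) (Seq copy_code (enum_code r)).

Lemma effect_setup n mem :
  let s' := foldl (@effect R)
    (State mem (fun j => if j == 0%N then n else 0%N) [::] [::]) setup_code in
  [/\ [/\ nats s' rSize = n, nats s' rOne = 1%N, nats s' rSucc = n.+1,
          nats s' rBase = (3 + n * d)%N & nats s' rLen = (n * d)%N],
      reals s' = mem, cset s' = [::] & osets s' = [::]].
Proof.
rewrite /setup_code !foldl_cat; set s0 := foldl _ (State _ _ _ _) _.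
set s1 := foldl _ s0 _.
have [[H0 H1 H2 H6] Hr Hc Ho] : [/\ [/\ nats s1 rSize = n, nats s1 rOne = 1%N,
    nats s1 rSucc = n.+1 & nats s1 rLen = (n * d)%N],
    reals s1 = mem, cset s1 = [::] & osets s1 = [::]].
  rewrite {}/s1; elim: (d) => [|j].
    by rewrite muln0; split=> //; split=> //=; rewrite /upd /= addn1.
  rewrite -[j.+1]addn1 nseqD foldl_cat.
  set s1 := foldl _ s0 _ => -[[H0 H1 H2 H6] Hr Hc Ho].
  split=> //; split=> //=.
  by rewrite /upd /= H6 H0 mulnDr muln1.
split=> //; split=> //=.
by rewrite /upd /= H6.
Qed.

Lemma wp_copy n mem s : (forall a, (n * d <= a)%N -> mem a = 0) ->
  [/\ nats s rSize = n, nats s rOne = 1%N, nats s rSucc = n.+1,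
      nats s rBase = (3 + n * d)%N & nats s rLen = (n * d)%N] ->
  [/\ reals s = mem, cset s = [::] & osets s = [::]] ->
  wp copy_code s (n * d * (3 + 3) + 2)
    (fun s' => [/\ inv n (3 + n * d) mem s', cset s' = [::] & osets s' = [::]]).
Proof.
move=> mem0 [H0 H1 H2 H3 H6] [Hr Hc Ho].
set N := (n * d)%N in mem0 H3 H6 *.
(* Cell 0 is the buffer, so it is claimed intact only at [j = 0]. The other source cells lie below
   [3 + N], where nothing is written, so they remain readable throughout. *)
pose J j s1 := [/\ [/\ nats s1 rSize = n, nats s1 rOne = 1%N, nats s1 rSucc = n.+1,
    nats s1 rBase = (3 + N)%N & nats s1 rLen = N],
  forall a, (a < j)%N -> reals s1 (3 + N + a)%N = mem a,
  forall a, (0 < a < 3 + N)%N || (3 + N + j <= a)%N || (j == 0)%N ->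
    reals s1 a = mem a,
  cset s1 = [::] & osets s1 = [::]].
apply: wp_weaken (@wp_for _ _ _ _ 3 N J s _ _ _ _) _ _ => //.
- by split=> //= a; rewrite Hr.
- move=> j s1 ltjN s1j [[K0 K1 K2 K3 K6] Klo Khi Kc Ko].
  apply: wp_weaken (wp_atoms _ _) _ _ => // s2 <- /=; split=> //.
  have memj : reals s1 j = mem j.
    by apply: Khi; case: (j) ltjN => // j' ltjN; rewrite /= ltn_addl.
  split=> //= a; rewrite /upd /= K3 s1j.
    rewrite ltnS leq_eqVlt eqn_add2l => /orP[/eqP->|ltaj].
      by rewrite eqxx.
    by rewrite ltn_eqF //= Klo.
  rewrite addnS orbF => Ha.
  have -> : (a == 3 + N + j)%N = false by apply/eqP; lia.
  have -> : (a == 0)%N = false by apply/eqP; lia.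
  by apply: Khi; case/orP: Ha => [->//|Ha]; rewrite (ltnW Ha) orbT.
move=> s' [[[K0 K1 K2 K3 K6] Klo Khi Kc Ko] _]; split=> //; split=> // a.
have [/Klo//|leNa] := ltnP a N.
(* Past the input, the original memory and its copy both read 0, so that index [n] designates the
   point 0. *)
rewrite Khi ?mem0 // ?leq_add2l ?leNa ?orbT //.
by rewrite (leq_trans leNa) // leq_addl.
Qed.

Lemma rreg_init0 (s : seq 'rV[R]_d) a : (size s * d <= a)%N -> rreg (init s) a = 0.
Proof. by move=> le; rewrite /= ltnNge le. Qed.

Lemma rreg_init (s : seq 'rV[R]_d) p (j : 'I_d) :
  rreg (init s) (p * d + j)%N = nth 0 s p ord0 j.
Proof.
have d0 : (0 < d)%N by apply: leq_ltn_trans (ltn_ord j).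
rewrite /= divnMDl // modnMDl divn_small // modn_small // addn0.
case: pickP => [j' /eqP/val_inj->|/(_ j)]; last by rewrite eqxx.
case: ifP => // /negbT; rewrite -leqNgt => le.
rewrite nth_default ?mxE // -ltnS -(ltn_pmul2r d0) mulSn addnC.
by apply: leq_ltn_trans le _; rewrite ltn_add2l.
Qed.

Theorem ram_enumeration (r : seq I) :
  exists (prog : seq (instr R)) (C : nat), forall s : seq 'rV[R]_d,
  exists2 k, (k <= C * (size s).+1 ^ d.+1)%N &
    let c := run prog k (init s) in
    halted prog c /\ forall q, q \in outs c <->
      exists i, i \in r /\
      exists g, (forall k, (k < d)%N -> (g k <= size s)%N) /\
        q = selected (size s) (rreg (init s)) (Ts i) g.
Proof.
pose code := gen (main_code r) 0; pose prog := code ++ [:: Halt R].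
exists prog, (size setup_code + (d * 6 + 2) + enum_cost r)%N => s.
set n := size s; set mem := rreg (init s).
have wp_main : wp (main_code r) (forget_pc (init s))
    (size setup_code + (n * d * (3 + 3) + 2 + enum_cost r * n.+1 ^ d.+1))
    (fun s' => forall q, q \in osets s' <-> exists i, i \in r /\
      exists g, (forall k, (k < d)%N -> (g k <= n)%N) /\
        q = selected n mem (Ts i) g).
  apply: wp_seq; apply: wp_weaken (wp_atoms _ _) _ _ => //.
    by rewrite !all_cat all_nseq orbT.
  move=> s1 <-; set s1' := foldl _ _ _.
  have [E1 Er Ec Eo] : _ := effect_setup n mem.
  apply: wp_seq; apply: wp_weaken (@wp_copy n mem s1' _ _ _) _ _ => //.
    exact: rreg_init0.
  move=> s2 [inv2 cs2 os2]; apply: wp_weaken (wp_enum r inv2 cs2) _ _ => // s3.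
  by move=> [O]; rewrite os2 => ->.
have [s' [k [lek Hs' Hrun]]] := wp_main.
have loc : located prog 0 code.
  by move=> j ltj; rewrite /prog /fetch nth_cat ltj.
exists k.
  apply: leq_trans lek _; rewrite !mulnDl addnA leq_add2r.
  have : (n.+1 <= n.+1 ^ d.+1)%N by rewrite expnS leq_pmulr // expn_gt0.
  by move: (_ ^ _)%N => X; nia.
have -> : run prog k (init s) = at_pc (0 + clen (main_code r)) s'.
  exact: (Hrun prog 0%N loc).
have fetchE : fetch prog (clen (main_code r)) = Halt R.
  by rewrite /fetch nth_cat size_gen ltnn subnn.
by split=> //; rewrite /halted -[pc _]/(clen (main_code r)) fetchE.
Qed.

End Enumeration.
End AffineTests.

(** * Vertices of hyperplane arrangements *)

Section Arrangement.
Set Implicit Arguments.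
Unset Strict Implicit.
Variable R : realFieldType.

(** The sign of [y] is in the closure of the sign of [x]. Required for all hyperplanes, this puts
    one point in the closure of the face of another. *)
Definition weakly_same (x y : R) : Prop :=
  [/\ 0 < x -> 0 <= y, x < 0 -> y <= 0 & x = 0 -> y = 0].

Lemma weakly_same_move x y z :
  weakly_same x y -> `|z| <= `|y| -> weakly_same x (y - z).
Proof.
move=> [pos neg zero] lezy; split=> Hx.
- have y0 := pos Hx; rewrite (ger0_norm y0) in lezy.
  by rewrite subr_ge0 (le_trans (ler_norm z)).
- have y0 := neg Hx; rewrite (ler0_norm y0) in lezy.
  by rewrite subr_le0 -lerN2 (le_trans _ lezy) // -normrN ler_norm.
- have y0 := zero Hx; move: lezy.
  by rewrite y0 normr0 normr_le0 => /eqP ->; rewrite subr0.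
Qed.

(** A minimum of finitely many positive bounds |a|/(|c|+1); the 1 avoids a division by 0. *)
Lemma small_scale (H : finType) (a c : H -> R) :
  exists2 e : R, 0 < e & forall h, a h != 0 -> e * `|c h| < `|a h|.
Proof.
suff [e e0 He] : exists2 e : R, 0 < e &
    forall h, h \in enum H -> a h != 0 -> e * `|c h| < `|a h|.
  by exists e => // h; apply: He; rewrite mem_enum.
elim: (enum H) => [|h r [e e0 He]]; first by exists 1.
have c1 : 0 < `|c h| + 1 by rewrite ltr_wpDl.
have [ah0|ahn0] := eqVneq (a h) 0.
  by exists e => // h'; rewrite inE => /orP[/eqP->|/He //]; rewrite ah0 eqxx.
exists (Num.min e (`|a h| / (`|c h| + 1))).
  by rewrite lt_min e0 divr_gt0 ?normr_gt0.
move=> h'; rewrite inE => /orP[/eqP-> _|/He /[apply]]; last first.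
  by apply: le_lt_trans; rewrite ler_wpM2r // ge_min lexx.
apply: (@le_lt_trans _ _ (`|a h| / (`|c h| + 1) * `|c h|)).
  by rewrite ler_wpM2r // ge_min lexx orbT.
by rewrite -mulrA gtr_pMr ?normr_gt0 // mulrC ltr_pdivrMr // mul1r ltrDl.
Qed.

(** A nonzero [a h] outweighs a small perturbation, while a vanishing one lets the sign of [c h]
    decide. *)
Lemma small_scale_sign (H : finType) (a c : H -> R) :
  exists2 e : R, 0 < e & forall h,
    (0 < a h + e * c h) = (0 < a h) || (0 < c h) && (a h == 0).
Proof.
have [e e0 He] := small_scale a c; exists e => // h.
have [->|an0] := eqVneq (a h) 0; first by rewrite ltxx andbT add0r pmulr_rgt0.
rewrite andbF orbF; have := He h an0.
rewrite -{1}(gtr0_norm e0) -normrM => Hlt.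
have [a0|a0] := ltrP 0 (a h).
  rewrite (gtr0_norm a0) ltr_norml in Hlt.
  by case/andP: Hlt => Hlt _; rewrite -ltrBlDl sub0r Hlt.
rewrite (ler0_norm a0) ltr_norml in Hlt.
by case/andP: Hlt => _ Hlt; apply/negbTE; rewrite -leNgt -lerBrDl sub0r ltW.
Qed.

Lemma row_full_inj m d (B : 'M[R]_(m, d)) (w : 'cV[R]_d) :
  row_full B -> B *m w = 0 -> w = 0.
Proof.
by case/row_fullP => C CB Bw0; rewrite -[w]mul1mx -CB -mulmxA Bw0 mulmx0.
Qed.

Lemma not_row_full m d (B : 'M[R]_(m, d)) :
  ~~ row_full B -> exists2 w : 'cV[R]_d, w != 0 & B *m w = 0.
Proof.
rewrite -cokermx_eq0 => /matrix0Pn[i [j Hij]].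
exists (col j (cokermx B)); last by rewrite colE mulmxA mulmx_coker mul0mx.
by apply: contraNneq Hij => /colP/(_ i); rewrite !mxE => ->.
Qed.

(* Move from [t] inside the closure of its face to a point lying on as many
   hyperplanes as possible. If the hyperplanes through that point did not span,
   one could slide along all of them until hitting another one. *)
Lemma exists_vertex m d (B : 'M[R]_(m, d)) (Q : finType) (q0 : Q)
    (c : 'I_m -> Q -> R) (t : 'cV[R]_d) : row_full B ->
  exists (v : 'cV[R]_d) (f : 'I_d -> 'I_m) (g : 'I_d -> Q),
    [/\ rowsub f B \in unitmx, rowsub f B *m v = \col_k c (f k) (g k) &
      forall i q, weakly_same ((B *m t) i ord0 - c i q) ((B *m v) i ord0 - c i q)].
Proof.
move=> fullB.
pose ht (h : 'I_m * Q) (v : 'cV[R]_d) := (B *m v) h.1 ord0 - c h.1 h.2.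
pose near v := forall h, weakly_same (ht h t) (ht h v).
pose tight v := [set h | ht h v == 0]%SET.
pose P k := `[< exists2 v, near v & #|tight v| = k >].
have exP : exists k, P k.
  exists #|tight t|; apply/asboolP; exists t => // h.
  by split=> // /ltW.
have ubP k : P k -> (k <= #|{: 'I_m * Q}|)%N.
  by move=> /asboolP[v _ <-]; exact: max_card.
case: (ex_maxnP exP ubP) => k0 /asboolP[v nearv <-] maxk {k0}.
(* Rows without a hyperplane through [v] are zeroed rather than removed, so that row indices of [T]
   remain row indices of [B]. *)
pose T : 'M[R]_(m, d) :=
  \matrix_(i, j) if [exists q, (i, q) \in tight v] then B i j else 0.
have TE i (w : 'cV[R]_d) : (T *m w) i ord0 =
    if [exists q, (i, q) \in tight v] then (B *m w) i ord0 else 0.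
  rewrite !mxE; case: ifP => Hi; last first.
    by rewrite big1 // => j _; rewrite mxE Hi mul0r.
  by apply: eq_bigr => j _; rewrite mxE Hi.
have fullT : row_full T.
  apply/negPn/negP => /not_row_full[w w0 Tw0].
  have [i0 Bi0] : exists i, (B *m w) i ord0 != 0.
    apply/existsP; apply: contraR w0; rewrite negb_exists => /forallP Bw0.
    apply/eqP; apply: (row_full_inj fullB); apply/colP => i; rewrite [RHS]mxE.
    by apply/eqP/negPn; exact: Bw0.
  pose sl (h : 'I_m * Q) := (B *m w) h.1 ord0.
  pose h0 : 'I_m * Q := (i0, q0).
  have slh0 : sl h0 != 0 by [].
  pose F h := `|ht h v / sl h|.
  (* Among the hyperplanes not parallel to [w], [h1] is one of the nearest to [v] along the line
     directed by [w]. Stopping there crosses no hyperplane, keeps the tight ones tight and adds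
     [h1], against maximality. *)
  case: (@arg_minP _ _ _ h0 (fun h => sl h != 0) F slh0) => h1 sl1 minh1.
  pose s := ht h1 v / sl h1; pose v' := v - s *: w.
  have htE h : ht h v' = ht h v - s * sl h.
    have mxB (X Y : 'cV[R]_m) i : (X - s *: Y) i ord0 = X i ord0 - s * Y i ord0.
      by rewrite !mxE.
    by rewrite /ht /v' mulmxBr -scalemxAr mxB addrAC.
  have tight0 h : h \in tight v -> sl h = 0.
    move=> Hh; have := TE h.1 w; rewrite Tw0 mxE ifT //.
    by apply/existsP; exists h.2; rewrite -surjective_pairing.
  have nearv' : near v'.
    move=> h; rewrite htE; apply: weakly_same_move (nearv h) _.
    have [->|slh] := eqVneq (sl h) 0; first by rewrite mulr0 normr0.
    have les : `|s| <= `|ht h v / sl h| by exact: minh1.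
    by rewrite normrM -ler_pdivlMr ?normr_gt0 // -normf_div.
  have : (#|tight v'| <= #|tight v|)%N.
    by apply: maxk; apply/asboolP; exists v'.
  rewrite leqNgt => /negP; apply; apply: proper_card; apply/properP; split.
    apply/fintype.subsetP => h Hh.
    by have := Hh; rewrite !inE htE (tight0 _ Hh) mulr0 subr0.
  exists h1; first by rewrite inE htE /s divfK // subrr.
  by apply: contra sl1 => /tight0 ->.
pose f := fullrankfun fullT.
have unitT : rowsub f T \in unitmx := fullrowsub_unit fullT.
(* An invertible matrix has no zero row, so no selected row was zeroed in [T]. *)
have tightf k : exists q, (f k, q) \in tight v.
  apply/existsP; apply: contraT => /negbTE Hk.
  have Tk0 : row k (rowsub f T) = 0 by apply/rowP => j; rewrite !mxE Hk.
  have := row_mul k (rowsub f T) (invmx (rowsub f T)).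
  rewrite Tk0 mul0mx mulmxV // => /rowP/(_ k)/eqP.
  by rewrite !mxE eqxx oner_eq0.
have [g gP] := choice tightf.
have fTB : rowsub f T = rowsub f B.
  by apply/matrixP => k j; rewrite !mxE ifT //; apply/existsP; exists (g k).
exists v, f, g; split; first by rewrite -fTB.
  apply/colP => k; rewrite mul_rowsub_mx !mxE.
  have := gP k; rewrite inE /ht /= subr_eq0 => /eqP <-.
  by rewrite mxE.
by move=> i q; exact: (nearv (i, q)).
Qed.

End Arrangement.

(** * Polyhedral windows *)

Section WindowInterior.
Set Implicit Arguments.
Unset Strict Implicit.
Variables (R : realType) (l d : nat) (A : 'M[R]_(l, d)) (b : 'cV[R]_l).

(** A zero row gives a condition independent of [x], so it stays weak. For a nonzero row, a small
    move along the row itself increases the form, which forces strictness; conversely, finitely many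
    positive gaps leave room for a ball. *)
Lemma interior_windowP (x : 'rV[R]_d) : interior (window A b) x <->
  forall i, if row i A == 0 then 0 <= b i ord0 else (A *m x^T) i ord0 < b i ord0.
Proof.
have mulE i (y : 'rV[R]_d) : (A *m y^T) i ord0 = \sum_j A i j * y ord0 j.
  by rewrite mxE; apply: eq_bigr => j _; rewrite mxE.
have row0 i (y : 'rV[R]_d) : row i A = 0 -> (A *m y^T) i ord0 = 0.
  move=> /rowP Ai0; rewrite mulE big1 // => j _.
  by have := Ai0 j; rewrite !mxE => ->; rewrite mul0r.
split=> [/nbhs_ballP[e /= e0 He] i|Hx].
  have Wx : window A b x by apply: He; exact: ballxx.
  case: eqP => [Ai0|/eqP Ain0]; first by have := Wx i; rewrite row0.
  have [e' e'0 He'] := small_scale (fun _ : 'I_d => e) (fun j => A i j).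
  pose y := x + e' *: row i A.
  have yE j : y ord0 j = x ord0 j + e' * A i j by rewrite !mxE.
  have Wy : window A b y.
    apply: He; split=> // i' j; rewrite (ord1 i') yE /ball /= opprD addNKr normrN.
    rewrite normrM (gtr0_norm e'0) -[ltRHS]gtr0_norm //.
    by apply: He'; rewrite gt_eqF.
  apply: lt_le_trans (Wy i); rewrite !mulE.
  under [ltRHS]eq_bigr do rewrite yE mulrDr mulrCA.
  rewrite big_split /= -mulr_sumr ltrDl pmulr_rgt0 //.
  have sq0 j : 0 <= A i j * A i j by rewrite -expr2 sqr_ge0.
  rewrite lt_def sumr_ge0 // andbT psumr_eq0 //.
  apply: contra Ain0 => /allP all0; apply/eqP/rowP => j; rewrite !mxE.
  by have := all0 j (mem_index_enum _); rewrite mulf_eq0 orbb => /eqP.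
have [e e0 He] := small_scale (fun i => b i ord0 - (A *m x^T) i ord0)
  (fun i => \sum_j `|A i j|).
apply/nbhs_ballP; exists e => //= y [_ Hy] i; have := Hx i.
case: eqP => [Ai0|_ ltb]; first by rewrite row0.
have gap : 0 < b i ord0 - (A *m x^T) i ord0 by rewrite subr_gt0.
have := He i (lt0r_neq0 gap); rewrite (gtr0_norm gap) ger0_norm ?sumr_ge0 // => Hlt.
have : (A *m y^T) i ord0 - (A *m x^T) i ord0 <= e * \sum_j `|A i j|.
  rewrite !mulE -sumrB mulr_sumr; apply: ler_sum => j _.
  rewrite -mulrBr mulrC; apply: le_trans (ler_norm _) _; rewrite normrM.
  rewrite ler_wpM2r // -normrN opprB ltW //; exact: (Hy ord0 j).
lra.
Qed.

Lemma SdotP (W : set 'rV[R]_d) (s : seq 'rV[R]_d) (t x : 'rV[R]_d) :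
  Sdot W [set y | y \in s] t x <-> x \in s /\ W (x - t).
Proof.
split=> [[/= xs [w Ww txw]]|[xs Wxt]].
  by split=> //; rewrite -txw addrAC subrr add0r.
by split=> //; exists (x - t) => //; rewrite addrC subrK.
Qed.

End WindowInterior.

(** * Vertices with directions yield exactly the separated sets *)

Section Separations.
Set Implicit Arguments.
Unset Strict Implicit.
Variables (R : realType) (l d : nat) (A : 'M[R]_(l, d)) (b : 'cV[R]_l).

(** This is entry i of b - A(p - v): [p] lies in v + W when it is nonnegative for all rows. *)
Definition slack (v : 'cV[R]_d) (p : 'rV[R]_d) (i : 'I_l) : R :=
  (A *m v) i ord0 - (A *m p^T) i ord0 + b i ord0.

(* The coordinate hyperplanes through the points are added, so that the
   arrangement has vertices even when A does not have full rank. *)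
Local Notation B := (col_mx A 1%:M : 'M[R]_(l + d, d)).
Local Notation b' := (col_mx b 0 : 'cV[R]_(l + d)).

Definition level (p : 'rV[R]_d) (i : 'I_(l + d)) : R :=
  (B *m p^T) i ord0 - b' i ord0.

(** The common point of the chosen hyperplanes if the submatrix is invertible. Otherwise [invmx] has
    a default value and some other point results, which is harmless because every point leads to a
    genuine set. *)
Definition vertex (f : 'I_d -> 'I_(l + d)) (p : 'I_d -> 'rV[R]_d) : 'cV[R]_d :=
  invmx (rowsub f B) *m \col_k level (p k) (f k).

(** Obtained by expanding the vertex inside the slack. For [k] up to [d], [insub k] fails only at
    [k = d], the slot of the tested point, which contributes [- A]. *)
Definition slack_coef (f : 'I_d -> 'I_(l + d)) (i : 'I_l) (k m : nat) : R :=
  if insub m is Some m' then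
    if insub k is Some k' then (A *m invmx (rowsub f B)) i k' * B (f k') m'
    else - A i m'
  else 0.

(** A vanishing slack is accepted if the direction increases it, as told by [e i], or on a zero row,
    whose inequality stays weak in the interior. *)
Definition slack_test (f : 'I_d -> 'I_(l + d)) (e : 'I_l -> bool) (i : 'I_l) :
    test R :=
  Test (b i ord0 - \sum_k (A *m invmx (rowsub f B)) i k * b' (f k) ord0)
       (slack_coef f i) (e i || (row i A == 0)).

Lemma slack_testE (f : 'I_d -> 'I_(l + d)) e i (s : seq 'rV[R]_d) x :
  test_val d (rreg (init s)) (slack_test f e i) x =
  slack (vertex f (fun k => nth 0 s (x k))) (nth 0 s (x d)) i.
Proof.
have := @rreg_init _ d s; move: (rreg (init s)) => mem memE.
rewrite /test_val big_ord_recr /=.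
under [X in _ + (X + _)]eq_bigr => k _.
  under eq_bigr => m _ do
    rewrite memE /slack_coef valK (valK k) -mulrA.
  rewrite -mulr_sumr.
  over.
under [X in _ + (_ + X)]eq_bigr => m _ do
  rewrite memE /slack_coef valK insubF ?ltnn // mulNr.
rewrite sumrN /slack /vertex mulmxA.
have mulE n (M : 'M[R]_(n, d)) j (y : 'rV[R]_d) :
    (M *m y^T) j ord0 = \sum_m M j m * y ord0 m.
  by rewrite mxE; apply: eq_bigr => m _; rewrite mxE.
rewrite -mulE [X in _ = X - _ + _]mxE.
under [X in _ = X - _ + _]eq_bigr => k _ do
  rewrite [X in _ * X]mxE /level mulrBr mulE.
rewrite sumrB; ring.
Qed.

(** Membership is compared row by row. The sign rule settles the nonzero rows; on a zero row every
    slack equals [b i ord0], and the closed test matches the weak inequality. *)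
Lemma selected_Sdot n (s : seq 'rV[R]_d) f (e : 'I_l -> bool)
    (g : nat -> nat) (t : 'cV[R]_d) : size s = n ->
  let v := vertex f (fun k => nth 0 s (g k)) in
  (forall i p, (p < n)%N -> (0 < slack t (nth 0 s p) i) =
     (0 < slack v (nth 0 s p) i) || e i && (slack v (nth 0 s p) i == 0)) ->
  [set x | exists2 p, p \in selected d n (rreg (init s))
                        [seq slack_test f e i | i <- enum 'I_l] g & x = nth 0 s p]
  = Sdot (interior (window A b)) [set x | x \in s] t^T.
Proof.
move=> ns v Hsign.
have passE p : (p < n)%N -> interior (window A b) (nth 0 s p - t^T) <->
    all (fun T => passes d (rreg (init s)) T (upd g d p))
        [seq slack_test f e i | i <- enum 'I_l].
  move=> ltpn; have pE i : passes d (rreg (init s)) (slack_test f e i) (upd g d p) =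
      (0 < slack v (nth 0 s p) i) ||
      (e i || (row i A == 0)) && (slack v (nth 0 s p) i == 0).
    have updE : upd g d p d = p by rewrite /upd eqxx.
    rewrite /passes slack_testE updE.
    suff -> : vertex f (fun k => nth 0 s (upd g d p k)) = v by [].
    by congr vertex; apply/funext => k; rewrite /upd ltn_eqF.
  have iE i : (if row i A == 0 then 0 <= b i ord0
      else (A *m (nth 0 s p - t^T)^T) i ord0 < b i ord0) =
      passes d (rreg (init s)) (slack_test f e i) (upd g d p).
    rewrite pE; have [Ai0|_] := eqVneq (row i A) 0.
      have mul0 (w : 'cV[R]_d) : (A *m w) i ord0 = 0.
        rewrite mxE big1 // => j _; move/rowP/(_ j): Ai0.
        by rewrite !mxE => ->; rewrite mul0r.
      by rewrite orbT /slack !mul0 subr0 add0r le0r orbC.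
    rewrite orbF -Hsign // linearB /= trmxK mulmxBr mxE [X in _ + X]mxE /slack.
    by apply/idP/idP; lra.
  rewrite interior_windowP all_map; split=> [H|/allP H i].
    by apply/allP => i _ /=; rewrite -iE; exact: H.
  by rewrite iE; apply: (H i); rewrite mem_enum.
apply/seteqP; split=> x.
  case=> p; rewrite mem_rev mem_filter mem_iota add0n => /andP[allp /= ltpn] ->.
  apply/SdotP; split; first by rewrite mem_nth ?ns.
  by case: (passE p ltpn) => _; apply; exact: allp.
case/SdotP => xs; have /(nthP 0)[p ltpn <-] := xs => Hint.
rewrite ns in ltpn; exists p => //.
rewrite mem_rev mem_filter mem_iota ltpn leq0n !andbT.
by case: (passE p ltpn) => /(_ Hint).
Qed.

(** Soundness: the translation is v + eps u, with one [eps] small enough for the finitely many pairs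
    of a row and a point. *)
Lemma selected_vertex_Sep (s : seq 'rV[R]_d) f (e : 'I_l -> bool) (g : nat -> nat)
    (u : 'cV[R]_d) : (forall i, e i = (0 < (A *m u) i ord0)) ->
  Sep (interior (window A b)) [set x | x \in s]
    [set x | exists2 p, p \in selected d (size s) (rreg (init s))
               [seq slack_test f e i | i <- enum 'I_l] g & x = nth 0 s p].
Proof.
move=> eE; set v := vertex f (fun k => nth 0 s (g k)).
have [eps eps0 Heps] := small_scale_sign
  (fun h : 'I_l * 'I_(size s) => slack v (nth 0 s h.2) h.1)
  (fun h => (A *m u) h.1 ord0).
exists (v + eps *: u)^T => //; symmetry; apply: selected_Sdot => // i p ltp.
rewrite eE -(Heps (i, Ordinal ltp)) /slack mulmxDr -scalemxAr.
have mxD (X Y : 'cV[R]_l) : (X + eps *: Y) i ord0 = X i ord0 + eps * Y i ord0.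
  by rewrite !mxE.
by rewrite mxD; congr (0 < _); ring.
Qed.

(** Completeness: [v] is a vertex in the closure of the face of [t], and the direction is
    [t^T - v]. *)
Lemma Sdot_selected_vertex (s : seq 'rV[R]_d) (t : 'rV[R]_d) :
  exists (f : {ffun 'I_d -> 'I_(l + d)}) (e : {ffun 'I_l -> bool}) (u : 'cV[R]_d)
    (g : nat -> nat),
  [/\ forall i, e i = (0 < (A *m u) i ord0),
      forall k, (k < d)%N -> (g k <= size s)%N &
      [set x | exists2 p, p \in selected d (size s) (rreg (init s))
                 [seq slack_test f e i | i <- enum 'I_l] g & x = nth 0 s p]
      = Sdot (interior (window A b)) [set x | x \in s] t].
Proof.
have fullB : row_full B.
  apply/row_fullP; exists (row_mx 0 1%:M).
  by rewrite mul_row_col mul0mx mul1mx add0r.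
(* Index [size s] reads the default 0 of [nth], so there are hyperplanes even for empty [s]. *)
have [v [f [g [unitB Bv near]]]] := exists_vertex (ord0 : 'I_(size s).+1)
  (fun i (q : 'I_(size s).+1) => level (nth 0 s q) i) t^T fullB.
pose g' k : nat := if insub k is Some k' then g k' else 0%N.
have vE : v = vertex [ffun k => f k] (fun k => nth 0 s (g' k)).
  have -> : v = invmx (rowsub f B) *m (\col_k level (nth 0 s (g k)) (f k)).
    by rewrite -Bv mulKmx.
  rewrite /vertex; have -> : ([ffun k => f k] : 'I_d -> 'I_(l + d)) = f.
    by apply/funext => k; rewrite ffunE.
  by congr (_ *m _); apply/colP => k; rewrite !mxE /g' valK.
exists [ffun k => f k], [ffun i => 0 < (A *m (t^T - v)) i ord0], (t^T - v), g'.
split=> [i|k ltkd|]; first by rewrite ffunE.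
  by rewrite /g' insubT -ltnS.
rewrite -[in RHS](trmxK t); apply: selected_Sdot => // i p ltp.
rewrite -vE ffunE.
have slackE (w : 'cV[R]_d) (q : 'rV[R]_d) :
    slack w q i = (B *m w) (lshift d i) ord0 - level q (lshift d i).
  by rewrite /slack /level !mul_col_mx !col_mxEu; ring.
have := near (lshift d i) (widen_ord (leqnSn _) (Ordinal ltp)).
rewrite -!slackE /= => -[pos neg zero].
set x := slack t^T _ i in pos neg zero *; set y := slack v _ i in pos neg zero *.
(* If [y] vanishes, the direction has the sign of [x]; if not, weak agreement of signs makes [x] and
   [y] positive together. *)
have -> : (A *m (t^T - v)) i ord0 = x - y.
  by rewrite mulmxBr mxE [X in _ + X]mxE /x /y /slack; ring.
have [->|y0] := eqVneq y 0; first by rewrite ltxx subr0 andbT.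
rewrite andbF orbF; have [x0|x0|x0] := ltrgtP 0 x.
- by rewrite lt_def y0 pos.
- by apply/esym/negbTE; rewrite -leNgt neg.
- by move: y0; rewrite zero // eqxx.
Qed.

End Separations.

Theorem theorem4p15 (R : realType) (d l : nat) (A : 'M[R]_(l, d)) (b : 'cV[R]_l) :
  exists (prog : seq (instr R)) (C : nat),
    forall s : seq 'rV[R]_d, uniq s ->
      computes_within prog s (C * (size s).+1 ^ d.+1)%N
        (Sep (interior (window A b)) [set x | x \in s]).
Proof.
pose I := ({ffun 'I_d -> 'I_(l + d)} * {ffun 'I_l -> bool})%type.
(* Only sign vectors realised by a direction are kept, so that each output is sound. This list
   depends on [A] and not on the input, hence it can be wired into the program. *)
pose r := [seq h : I <- enum {: I} |
  `[< exists u : 'cV[R]_d, forall i, h.2 i = (0 < (A *m u) i ord0) >]].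
pose Ts (h : I) := [seq slack_test A b h.1 h.2 i | i <- enum 'I_l].
have [prog [C HC]] := ram_enumeration d Ts r.
exists prog, C => s _; have [k lek [Hhalt Houts]] := HC s.
exists k => //; split=> //.
  apply/allP => q /Houts[h [_ [g [_ ->]]]]; apply/allP => p.
  by rewrite mem_rev mem_filter mem_iota => /andP[_ /=].
apply/seteqP; split=> [Q [q /Houts[h [hr [g [_ ->]]]] ->]|Q [t _ <-]].
  move: hr; rewrite mem_filter => /andP[/asboolP[u uE] _].
  exact: selected_vertex_Sep uE.
have [f [e [u [g [eE gle <-]]]]] := Sdot_selected_vertex A b s t.
exists (selected d (size s) (rreg (init s)) (Ts (f, e)) g) => //.
apply/Houts; exists (f, e); split; last by exists g.
by rewrite mem_filter mem_enum andbT; apply/asboolP; exists u.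
Qed.
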